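(* Let $k\ge1$, $\mathbf x=(x_1,\ldots,x_k)$, $\mathbf r=(r_1,\ldots,r_k)$, $\mathbf y=(y_1,y_2,\ldots)$, $\mathbf s=(s_1,s_2,\ldots)$, and let $\lambda,\mu$ be signatures. For $i\in\{1,\ldots,k-1\}$ let $\sigma_i$ act on a sequence by swapping its $i$-th and $(i+1)$-st elements. Then for each $i\in\{1,\ldots,k-1\}$, $$G_{\lambda/\mu}(\sigma_i(\mathbf x);\mathbf y;\sigma_i(\mathbf r);\mathbf s)=G_{\lambda/\mu}(\mathbf x;\mathbf y;\mathbf r;\mathbf s),$$ $$F_{\lambda/\mu}(\sigma_i(\mathbf x);\mathbf y;\sigma_i(\mathbf r);\mathbf s)=\frac{x_i-x_{i+1}r_{i+1}^{-2}}{x_{i+1}-x_ir_i^{-2}}\,F_{\lambda/\mu}(\mathbf x;\mathbf y;\mathbf r;\mathbf s).$$ In other words, the functions $G_{\lambda/\mu}(\mathbf x;\mathbf y;\mathbf r;\mathbf s)$ and $F_{\lambda/\mu}(\mathbf x;\mathbf y;\mathbf r;\mathbf s)\prod_{1\le i<j\le k}(x_i-x_jr_j^{-2})$ are symmetric under simultaneous permutations of the pairs of variables $(x_j,r_j)$.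
   Context: Signatures. A signature with $n$ parts is an integer sequence $\lambda=(\lambda_1\ge\ldots\ge\lambda_n\ge0)$, $n\ge0$; $\mathcal S(\lambda)=\{\lambda_j+n+1-j:1\le j\le n\}\subset\mathbb Z_{\ge1}$. Vertex weights. For $i_1,j_1,i_2,j_2\in\{0,1\}$ (numbers of paths entering from the bottom, entering from the left, exiting at the top, exiting to the right) put $W(\cdot)=W(\cdot\mid x;y;r;s)$ with $W(0,0;0,0)=1$, $W(1,1;1,1)=\frac{r^{-2}x-y}{s^{-2}y-x}$, $W(1,0;1,0)=\frac{s^{-2}y-r^{-2}x}{s^{-2}y-x}$, $W(0,1;0,1)=\frac{y-x}{s^{-2}y-x}$, $W(1,0;0,1)=\frac{x(r^{-2}-1)}{s^{-2}y-x}$, $W(0,1;1,0)=\frac{y(s^{-2}-1)}{s^{-2}y-x}$, and $W=0$ otherwise. Put $\widehat W=W/W(0,1;0,1)$. Partition functions. A configuration on $\mathbb Z_{\ge1}\times\{1,\ldots,k\}$ consists of vertical edge states $v(i,j)\in\{0,1\}$ ($i\ge1$, $0\le j\le k$; $v(i,j-1)$ below and $v(i,j)$ above the vertex $(i,j)$) and horizontal edge states $h(i,j)\in\{0,1\}$ ($i\ge0$, $1\le j\le k$; $h(i-1,j)$ to the left and $h(i,j)$ to the right of $(i,j)$). If $\lambda,\mu$ have the same number of parts, $G_{\lambda/\mu}(\mathbf x;\mathbf y;\mathbf r;\mathbf s)$ is the sum over configurations with $v(i,0)=\mathbf 1_{i\in\mathcal S(\mu)}$, $v(i,k)=\mathbf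 1_{i\in\mathcal S(\lambda)}$, $h(0,j)=0$, $h(i,j)=0$ for all large $i$, of $\prod_{i,j}W(v(i,j-1),h(i-1,j);v(i,j),h(i,j)\mid x_j;y_i;r_j;s_i)$; otherwise $G_{\lambda/\mu}=0$. If $\lambda$ has $n+k$ parts and $\mu$ has $n$ parts for some $n\ge0$, $F_{\lambda/\mu}(\mathbf x;\mathbf y;\mathbf r;\mathbf s)$ is the sum over configurations with $v(i,0)=\mathbf 1_{i\in\mathcal S(\lambda)}$, $v(i,k)=\mathbf 1_{i\in\mathcal S(\mu)}$, $h(0,j)=0$, $h(i,j)=1$ for all large $i$, of the same product with $\widehat W$ in place of $W$; otherwise $F_{\lambda/\mu}=0$. These sums have finitely many nonzero terms, each with all but finitely many factors equal to $1$. The identities are between rational functions: parameters are assumed such that no denominator vanishes. *)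

(* Defs.v *)
From mathcomp Require Import all_boot all_order all_algebra all_fingroup.
From mathcomp Require Import boolp classical_sets fsbigop.

Set Implicit Arguments.
Unset Strict Implicit.
Unset Printing Implicit Defensive.

Import GRing.Theory.
Local Open Scope ring_scope.

Definition is_signature (lam : seq nat) : bool := sorted geq lam.

(* S(lam) = {lam_j + n + 1 - j : 1 <= j <= n}, where lam_j = nth 0 lam (j - 1). *)
Definition occupied (lam : seq nat) : seq nat :=
  [seq (nth 0 lam j.-1 + (size lam).+1 - j)%N | j <- iota 1 (size lam)].

Section Weights.
Variable K : fieldType.

Definition W (i1 j1 i2 j2 : bool) (x y r s : K) : K :=
  match i1, j1, i2, j2 with
  | false, false, false, false => 1
  | true, true, true, true => (r ^- 2 * x - y) / (s ^- 2 * y - x)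
  | true, false, true, false => (s ^- 2 * y - r ^- 2 * x) / (s ^- 2 * y - x)
  | false, true, false, true => (y - x) / (s ^- 2 * y - x)
  | true, false, false, true => x * (r ^- 2 - 1) / (s ^- 2 * y - x)
  | false, true, true, false => y * (s ^- 2 - 1) / (s ^- 2 * y - x)
  | _, _, _, _ => 0
  end.

Definition What (i1 j1 i2 j2 : bool) (x y r s : K) : K :=
  W i1 j1 i2 j2 x y r s / W false true false true x y r s.

End Weights.

(* Columns and rows are numbered from 0: i : nat stands for column i + 1 of
   Z_{>=1}, so y i and s i stand for y_{i+1} and s_{i+1}, and
   j : 'I_k stands for row j + 1.
   A configuration c has the vertical edges c.1 i l, with l : 'I_k.+1 the height
   of the edge (l = 0 at the bottom), and the horizontal edges c.2 i j, where
   c.2 i j is to the left of the vertex (i, j) and c.2 i.+1 j to its right.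
   There are no other edges, so distinct terms are distinct configurations. *)
Definition config (k : nat) : Type :=
  ((nat -> 'I_k.+1 -> bool) * (nat -> 'I_k -> bool))%type.

Definition vertex_weight (K : fieldType) (k : nat)
    (w : bool -> bool -> bool -> bool -> K -> K -> K -> K -> K)
    (x : 'I_k -> K) (y : nat -> K) (r : 'I_k -> K) (s : nat -> K)
    (c : config k) (p : nat * 'I_k) : K :=
  let: (i, j) := p in
  w (c.1 i (widen_ord (leqnSn k) j)) (c.2 i j)
    (c.1 i (lift ord0 j)) (c.2 i.+1 j) (x j) (y i) (r j) (s i).

(* The finitely supported product is 1 when infinitely many factors differ from
   1. Under the boundary conditions of configs this happens only when
   infinitely many factors are 0, hence the test. *)
Definition config_weight (K : fieldType) (k : nat)
    (w : bool -> bool -> bool -> bool -> K -> K -> K -> K -> K)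
    (x : 'I_k -> K) (y : nat -> K) (r : 'I_k -> K) (s : nat -> K)
    (c : config k) : K :=
  if `[< exists p, vertex_weight w x y r s c p = 0 >] then 0
  else \big[*%R/1]_(p \in [set: nat * 'I_k]) vertex_weight w x y r s c p.

Definition configs (k : nat) (bot top : seq nat) (right : bool) :
    set (config k) :=
  [set c : config k |
    [/\ forall i, c.1 i ord0 = (i.+1 \in bot),
        forall i, c.1 i ord_max = (i.+1 \in top),
        forall j, c.2 0%N j = false
      & exists N, forall i j, (N <= i)%N -> c.2 i j = right]].

Definition G (K : fieldType) (k : nat) (lam mu : seq nat)
    (x : 'I_k -> K) (y : nat -> K) (r : 'I_k -> K) (s : nat -> K) : K :=
  if size lam == size mu then
    \sum_(c \in configs (occupied mu) (occupied lam) false)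
      config_weight (@W K) x y r s c
  else 0.

Definition F (K : fieldType) (k : nat) (lam mu : seq nat)
    (x : 'I_k -> K) (y : nat -> K) (r : 'I_k -> K) (s : nat -> K) : K :=
  if size lam == (size mu + k)%N then
    \sum_(c \in configs (occupied lam) (occupied mu) true)
      config_weight (@What K) x y r s c
  else 0.

(* Main.v *)
Require Import Defs.
From mathcomp Require Import all_boot all_order all_algebra all_fingroup.
From mathcomp Require Import boolp classical_sets fsbigop.
From mathcomp Require Import ring zify.

Set Implicit Arguments.
Unset Strict Implicit.
Unset Printing Implicit Defensive.

Import GRing.Theory.
Local Open Scope ring_scope.

(* Multiplied by their common denominator, the vertex weights are polynomials and
   satisfy the Yang-Baxter equation with polynomial crossing weights. Summing over
   the vertical edges of one column gives an operator on the states of the k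
   horizontal edges between columns; by the Yang-Baxter equation, crossing rows i
   and i+1 intertwines this operator with the one in which (x_i, r_i) and
   (x_{i+1}, r_{i+1}) are swapped. Moving the crossing through all columns leaves,
   on either side, only the weight of an empty or of a full crossing: both ends are
   empty for G, whereas for F the right end is full, and the ratio of these two
   weights is the factor in the exchange relation for F. Conservation of paths
   makes every configuration of nonzero weight trivial beyond a fixed column, so
   the operators of finitely many columns suffice. *)

(** * Denominator-free vertex weights and the Yang-Baxter equation *)

Section VertexWeights.
Variable A : comNzRingType.

(* W multiplied by s^-2 y - x, with q for r^-2 and t for s^-2. *)
Definition vertex (i1 j1 i2 j2 : bool) (x y q t : A) : A :=
  match i1, j1, i2, j2 with
  | false, false, false, false => t * y - x
  | true, true, true, true => q * x - y
  | true, false, true, false => t * y - q * x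
  | false, true, false, true => y - x
  | true, false, false, true => x * (q - 1)
  | false, true, true, false => y * (t - 1)
  | _, _, _, _ => 0
  end.

(* Found by solving [yang_baxter] for crossing weights that conserve paths;
   row 1 is the lower one to the right of the crossing and the upper one to its
   left. *)
Definition cross (a b c d : bool) (x1 q1 x2 q2 : A) : A :=
  match a, b, c, d with
  | false, false, false, false => x1 - x2 * q2
  | true, true, true, true => x2 - x1 * q1
  | true, false, true, false => x1 * (1 - q1)
  | false, true, false, true => x2 * (1 - q2)
  | true, false, false, true => q1 * x1 - q2 * x2
  | false, true, true, false => x1 - x2
  | _, _, _, _ => 0
  end.

(** Each of the 64 boundary states gives a polynomial identity. Without denominators it holds over
    every commutative ring, in particular over the ring [{poly K}] needed below. *)
Lemma yang_baxter (x1 q1 x2 q2 y t : A) (a b c d v0 v2 : bool) :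
  \sum_(p : bool * bool) \sum_(v : bool)
    cross a b p.1 p.2 x1 q1 x2 q2 *
      (vertex v0 p.1 v c x1 y q1 t * vertex v p.2 v2 d x2 y q2 t) =
  \sum_(p : bool * bool) \sum_(v : bool)
    vertex v0 a v p.1 x2 y q2 t * vertex v b v2 p.2 x1 y q1 t *
      cross p.1 p.2 c d x1 q1 x2 q2.
Proof.
have sum_bool2 (f : bool * bool -> A) :
    \sum_p f p = f (true, true) + f (true, false) + (f (false, true) + f (false, false)).
  transitivity (\sum_p \sum_p' f (p, p')); last by rewrite !big_bool.
  by rewrite pair_bigA; apply: eq_bigr => -[].
rewrite !sum_bool2 !big_bool.
by case: a b c d v0 v2 => [] [] [] [] [] []; rewrite /=; ring.
Qed.

End VertexWeights.

Lemma rmorph_vertex (A B : comNzRingType) (f : {rmorphism A -> B})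
    i1 j1 i2 j2 (x y q t : A) :
  f (vertex i1 j1 i2 j2 x y q t) = vertex i1 j1 i2 j2 (f x) (f y) (f q) (f t).
Proof.
by case: i1 j1 i2 j2 => [] [] [] []; rewrite /= ?(rmorphB, rmorphM, rmorph0, rmorph1).
Qed.

(** * Products of transfer matrices as sums over paths *)

Section PathSums.
Variables (A : comNzRingType) (S : finType).

(** This is an entry of the matrix product of the [T i], expanded over all intermediate states. It
    serves twice: for the vertical edges of one column ([S] is [bool]), and for the succession of
    columns ([S] is the set of states of [k] horizontal edges). *)
Definition path_sum n (T : 'I_n -> S -> S -> A) (a b : S) : A :=
  \sum_(h : {ffun 'I_n.+1 -> S} | (h ord0 == a) && (h ord_max == b))
    \prod_(i < n) T i (h (widen_ord (leqnSn n) i)) (h (lift ord0 i)).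

Lemma eq_path_sum n (T T' : 'I_n -> S -> S -> A) a b :
  (forall i a b, T i a b = T' i a b) -> path_sum T a b = path_sum T' a b.
Proof. by move=> eqT; apply: eq_bigr => h _; apply: eq_bigr => i _. Qed.

Lemma path_sum0 (T : 'I_0 -> S -> S -> A) a b : path_sum T a b = (a == b)%:R.
Proof.
rewrite /path_sum (reindex (fun c => [ffun _ : 'I_1 => c])) /=; last first.
  exists (fun h : {ffun 'I_1 -> S} => h ord0) => [c|h] _; rewrite ?ffunE //.
  by apply/ffunP => i; rewrite ffunE (ord1 i).
rewrite (eq_bigl (fun c => (c == a) && (c == b))) => [|c]; last by rewrite !ffunE.
under eq_bigr do rewrite big_ord0.
by rewrite big_mkcondr big_pred1_eq; case: eqP.
Qed.

Lemma path_sumS n (T : 'I_n.+1 -> S -> S -> A) a b :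
  path_sum T a b =
    \sum_c path_sum (T \o widen_ord (leqnSn n)) a c * T ord_max c b.
Proof.
pose extend (p : {ffun 'I_n.+1 -> S} * S) : {ffun 'I_n.+2 -> S} :=
  [ffun i => if unlift ord_max i is Some j then p.1 j else p.2].
have extend_lift p (i : 'I_n.+1) : extend p (widen_ord (leqnSn n.+1) i) = p.1 i.
  rewrite ffunE (_ : widen_ord _ i = lift ord_max i) ?liftK //.
  by apply: val_inj; rewrite /= /bump leqNgt ltn_ord.
have extend_max p : extend p ord_max = p.2 by rewrite ffunE unlift_none.
rewrite /path_sum (reindex extend) /=; last first.
  exists (fun h => ([ffun i => h (lift ord_max i)], h ord_max)) => [[h c]|h] _.
    by congr pair; rewrite ?extend_max //; apply/ffunP => i; rewrite !ffunE liftK.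
  apply/ffunP => i; rewrite ffunE; case: unliftP => [j ->|->] //=.
  by rewrite ffunE.
have extend0 p : extend p ord0 = p.1 ord0.
  by rewrite -extend_lift; congr (extend p _); apply: val_inj.
under eq_bigl do rewrite extend0 extend_max.
(* The last state is forced to be [b], so only the earlier ones are summed; these are then sorted by
   the state [c] before the last step. *)
transitivity (\sum_(h : {ffun 'I_n.+1 -> S} | h ord0 == a)
    (\prod_(i < n) T (widen_ord (leqnSn n) i) (h (widen_ord (leqnSn n) i))
       (h (lift ord0 i))) * T ord_max (h ord_max) b).
  rewrite [RHS](eq_bigr (fun h : {ffun 'I_n.+1 -> S} => \sum_(c | c == b)
      (\prod_(i < n) T (widen_ord (leqnSn n) i) (h (widen_ord (leqnSn n) i))
       (h (lift ord0 i))) * T ord_max (h ord_max) c)); last first.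
    by move=> h _; rewrite big_pred1_eq.
  rewrite pair_big /=; apply: eq_bigr => -[h c] /= _.
  rewrite big_ord_recr /=; congr (_ * _).
    apply: eq_bigr => i _; rewrite extend_lift /=; congr (T _ _ _).
    by rewrite -[RHS](extend_lift (h, c)); congr (extend _ _); apply: val_inj.
  rewrite extend_lift (_ : lift _ _ = ord_max) ?extend_max //.
  by apply: val_inj.
rewrite (partition_big (fun h : {ffun _} => h ord_max) predT) //=.
by apply: eq_bigr => c _; rewrite big_distrl; apply: eq_bigr => h /andP[_ /eqP->].
Qed.

Lemma path_sumZ n (z : 'I_n -> A) (T : 'I_n -> S -> S -> A) a b :
  path_sum (fun i a b => z i * T i a b) a b = (\prod_i z i) * path_sum T a b.
Proof. by rewrite big_distrr; apply: eq_bigr => h _; rewrite big_split. Qed.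

End PathSums.

Lemma rmorph_path_sum (A B : comNzRingType) (f : {rmorphism A -> B})
    (S : finType) n (T : 'I_n -> S -> S -> A) a b :
  f (path_sum T a b) = path_sum (fun i a b => f (T i a b)) a b.
Proof. by rewrite rmorph_sum; apply: eq_bigr => h _; rewrite rmorph_prod. Qed.

(** * Partition functions of finitely many columns *)

Section PartitionFunction.
Variables (A : comNzRingType) (k : nat).

Definition column_sum (u : 'I_k -> bool -> bool -> bool -> bool -> A)
    (bot top : bool) (h h' : {ffun 'I_k -> bool}) : A :=
  path_sum (fun j v v' => u j v (h j) v' (h' j)) bot top.

Definition partition_function N
    (u : nat -> 'I_k -> bool -> bool -> bool -> bool -> A)
    (bot top : seq nat) (right : bool) : A :=
  path_sum (fun i : 'I_N => column_sum (u i) (i.+1 \in bot) (i.+1 \in top))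
    [ffun=> false] [ffun=> right].

Lemma eq_partition_function N u u' bot top right :
  (forall i j a b c d, u i j a b c d = u' i j a b c d) ->
  partition_function N u bot top right = partition_function N u' bot top right.
Proof.
by move=> eq_u; apply: eq_path_sum => i h h'; apply: eq_path_sum => j v v'.
Qed.

(** Serves to extract the denominators of the vertex weights. *)
Lemma partition_functionZ N (z : nat -> 'I_k -> A) u bot top right :
  partition_function N (fun i j a b c d => z i j * u i j a b c d) bot top right =
  (\prod_(i < N) \prod_j z i j) * partition_function N u bot top right.
Proof.
rewrite -path_sumZ; apply: eq_path_sum => i h h'.
by rewrite -path_sumZ; apply: eq_path_sum.
Qed.

End PartitionFunction.

Lemma rmorph_partition_function (A B : comNzRingType) (f : {rmorphism A -> B})
    k N (u : nat -> 'I_k -> _) bot top right :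
  f (partition_function N u bot top right) =
  partition_function N (fun i j a b c d => f (u i j a b c d)) bot top right.
Proof.
rewrite rmorph_path_sum; apply: eq_path_sum => i h h'.
by rewrite rmorph_path_sum; apply: eq_path_sum.
Qed.

(** * Exchange of two adjacent rows *)

Definition update (I : finType) (S : Type) (h : {ffun I -> S}) i c :=
  [ffun j => if j == i then c else h j].

(** Functions that are false at [m] represent the classes of functions agreeing away from [m]. This
    singles out the sum over one edge. *)
Lemma sum_ffun_bool (A : comNzRingType) (I : finType) (P : pred {ffun I -> bool})
    (m : I) (f : {ffun I -> bool} -> A) :
  (forall h c, P (update h m c) = P h) ->
  \sum_(h | P h) f h = \sum_(h | P h && ~~ h m) \sum_c f (update h m c).
Proof.
move=> P_update; rewrite (partition_big (fun h : {ffun I -> bool} => h m) predT) //=.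
rewrite [RHS]exchange_big; apply: eq_bigr => c _.
rewrite (reindex_onto (fun h => update h m c) (fun h => update h m false)) /=.
  apply: eq_bigl => h; rewrite P_update ffunE eqxx eqxx andbT; congr (_ && _).
  apply/eqP/idP => [<-|hm]; first by rewrite ffunE eqxx.
  by apply/ffunP => j; rewrite !ffunE; case: eqP => // ->; case: (h m) hm.
move=> h /andP[_ /eqP hm]; apply/ffunP => j; rewrite !ffunE.
by case: eqP => // ->.
Qed.

Section RowExchange.
Variables (A : comNzRingType) (k : nat) (i i' : 'I_k).
Hypothesis i'E : i' = i.+1 :> nat.
Variables (x q : 'I_k -> A) (y t : nat -> A).

Let ii' : i != i'. Proof. by rewrite -val_eqE /= i'E neq_ltn leqnn. Qed.

Definition update2 (h : {ffun 'I_k -> bool}) (p : bool * bool) :=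
  update (update h i' p.2) i p.1.

Definition row_weight (x q : 'I_k -> A) n (j : 'I_k) a b c d : A :=
  vertex a b c d (x j) (y n) (q j) (t n).

Notation crossing a b c d := (cross a b c d (x i) (q i) (x i') (q i')).
Notation tau := (tperm i i').

(** Only one vertical edge joins the two rows. With the other vertical edges fixed, summing over it
    and over the crossing gives [yang_baxter] times the factor of the remaining rows, common to both
    sides. *)
Lemma column_exchange n bot top (h h' : {ffun 'I_k -> bool}) :
  \sum_p crossing (h i) (h i') p.1 p.2 *
    column_sum (row_weight x q n) bot top (update2 h p) h' =
  \sum_p column_sum (row_weight (x \o tau) (q \o tau) n) bot top h (update2 h' p) *
    crossing p.1 p.2 (h' i) (h' i').
Proof.
(* The height of the edge above row [i], which is also the edge below row [i']; hence it is neither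
   the bottom nor the top edge. *)
pose m := lift ord0 i.
have mE : m = widen_ord (leqnSn k) i' by apply: val_inj; rewrite /= i'E.
have m0 : ord0 != m by [].
have mk : ord_max != m.
  by rewrite -val_eqE /= /bump /= add1n -i'E neq_ltn ltn_ord orbT.
have isolate u g g' : column_sum u bot top g g' =
    \sum_(v : {ffun 'I_k.+1 -> bool} |
        (v ord0 == bot) && (v ord_max == top) && ~~ v m)
      \sum_b \prod_j u j (update v m b (widen_ord (leqnSn k) j)) (g j)
                         (update v m b (lift ord0 j)) (g' j).
  apply: sum_ffun_bool => v b.
  by rewrite !ffunE (negPf m0) (negPf mk).
under eq_bigr do rewrite isolate big_distrr.
under [RHS]eq_bigr do rewrite isolate big_distrl.
rewrite exchange_big [RHS]exchange_big; apply: eq_bigr => v _ /=.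
have split2 f : \prod_j f j = f i * f i' * \prod_(j | (j != i) && (j != i')) f j :> A.
  by rewrite (bigD1 i) //= (bigD1 i') //= 1?eq_sym // mulrA.
pose rest := \prod_(j | (j != i) && (j != i'))
  row_weight x q n j (v (widen_ord (leqnSn k) j)) (h j) (v (lift ord0 j)) (h' j).
have widen_m j : (widen_ord (leqnSn k) j == m) = (j == i').
  by rewrite mE.
have lift_m j : (lift ord0 j == m) = (j == i).
  by rewrite (inj_eq lift_inj).
have i'i : (i' == i) = false by rewrite eq_sym; exact/negbTE.
transitivity (rest * \sum_(p : bool * bool) \sum_b
    crossing (h i) (h i') p.1 p.2 *
      (vertex (v (widen_ord (leqnSn k) i)) p.1 b (h' i) (x i) (y n) (q i) (t n) *
       vertex b p.2 (v (lift ord0 i')) (h' i') (x i') (y n) (q i') (t n))).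
  rewrite big_distrr; apply: eq_bigr => p _; rewrite !big_distrr.
  apply: eq_bigr => b _; rewrite split2 [LHS]mulrA [RHS]mulrC; congr (_ * _).
    by rewrite /row_weight !ffunE !widen_m !lift_m !eqxx (negPf ii') i'i.
  apply: eq_bigr => j /andP[/negPf ji /negPf ji'].
  by rewrite !ffunE widen_m lift_m ji ji'.
rewrite yang_baxter big_distrr; apply: eq_bigr => p _.
rewrite !(big_distrr, big_distrl); apply: eq_bigr => b _ /=.
rewrite split2 mulrA; congr (_ * _); rewrite mulrC; congr (_ * _).
  rewrite /row_weight !ffunE !widen_m !lift_m !eqxx (negPf ii') i'i /=.
  by rewrite tpermL tpermR.
apply: eq_bigr => j /andP[ji ji'].
rewrite /row_weight !ffunE widen_m lift_m (negPf ji) (negPf ji') /=.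
by rewrite tpermD // eq_sym.
Qed.

Lemma update2K h p : update2 (update2 h p) (h i, h i') = h.
Proof.
apply/ffunP => j; rewrite !ffunE.
by case: (eqVneq j i) => [->|_] //; case: (eqVneq j i') => [->|_].
Qed.

(** The crossing is moved through one column at a time, by induction on the number of columns. *)
Lemma path_exchange n (T T' : 'I_n -> {ffun 'I_k -> bool} -> {ffun 'I_k -> bool} -> A)
    (r : bool -> bool -> bool -> bool -> A) :
  (forall m (h h' : {ffun 'I_k -> bool}),
    \sum_p r (h i) (h i') p.1 p.2 * T m (update2 h p) h' =
    \sum_p T' m h (update2 h' p) * r p.1 p.2 (h' i) (h' i')) ->
  forall h h' : {ffun 'I_k -> bool},
    \sum_p r (h i) (h i') p.1 p.2 * path_sum T (update2 h p) h' =
    \sum_p path_sum T' h (update2 h' p) * r p.1 p.2 (h' i) (h' i').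
Proof.
have update2i g p : update2 g p i = p.1 by rewrite !ffunE eqxx.
have update2i' g p : update2 g p i' = p.2.
  by rewrite !ffunE eqxx eq_sym (negPf ii').
elim: n T T' => [|n IHn] T T' exT h h'.
  under eq_bigr do rewrite path_sum0.
  under [RHS]eq_bigr do rewrite path_sum0.
  (* Without columns each side is a single crossing weight if [h] and [h'] agree outside the two
     rows, and 0 otherwise. *)
  case: (boolP [exists p, update2 h p == h']) => [/existsP[p /eqP <-]|no_p].
    rewrite (bigD1 p) //= eqxx mulr1 big1 ?addr0; last first.
      move=> p' p'p; case: eqP => [eqp|]; last by rewrite mulr0.
      case/eqP: p'p; move: (congr1 (fun g : {ffun _} => (g i, g i')) eqp) => /=.
      by rewrite !update2i !update2i' -!surjective_pairing.
    rewrite (bigD1 (h i, h i')) //= update2K eqxx mul1r update2i update2i'.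
    rewrite big1 ?addr0 // => p' p'p; case: eqP => [eqp|]; last by rewrite mul0r.
    by case/eqP: p'p; rewrite eqp update2i update2i' -surjective_pairing.
  rewrite !big1 // => p _; case: eqP => [eqp|]; rewrite ?(mul0r, mulr0) //.
    by case/existsP: no_p; exists (h' i, h' i'); rewrite eqp update2K.
  by case/existsP: no_p; exists p; rewrite eqp.
under eq_bigr do rewrite path_sumS big_distrr.
under [RHS]eq_bigr do rewrite path_sumS big_distrl.
rewrite exchange_big [RHS]exchange_big /=.
under eq_bigr => c _.
  under eq_bigr do rewrite mulrA.
  rewrite -big_distrl /= (IHn _ (T' \o widen_ord (leqnSn n)));
    last by move=> *; exact: exT.
  rewrite big_distrl /=.
  under eq_bigr do rewrite -mulrA.
  over.
under [RHS]eq_bigr => c _.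
  under eq_bigr do rewrite -mulrA.
  rewrite -big_distrr /= -exT big_distrr /=.
  over.
(* The two double sums differ by the involution that exchanges [p] with the states of [c] in rows
   [i] and [i']. *)
rewrite !pair_bigA /= (reindex (fun a => (update2 a.1 a.2, (a.1 i, a.1 i')))).
  apply: eq_bigr => -[c p] _ /=.
  by rewrite update2K update2i update2i'.
exists (fun a => (update2 a.1 a.2, (a.1 i, a.1 i'))) => -[c p] _ /=;
  by rewrite update2K update2i update2i' -surjective_pairing.
Qed.

Lemma partition_function_exchange N bot top right :
  (x i - x i' * q i') *
    partition_function N (row_weight x q) bot top right =
  partition_function N (row_weight (x \o tau) (q \o tau)) bot top right *
    (if right then x i' - x i * q i else x i - x i' * q i').
Proof.
pose columns x q (m : 'I_N) :=
  column_sum (row_weight x q m) (m.+1 \in bot) (m.+1 \in top).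
have := @path_exchange N (columns x q) (columns (x \o tau) (q \o tau))
  (fun a b c d => crossing a b c d)
  (fun m => column_exchange m (m.+1 \in bot) (m.+1 \in top))
  [ffun=> false] [ffun=> right].
have update2_const b : update2 [ffun=> b] (b, b) = [ffun=> b].
  by apply/ffunP => j; rewrite !ffunE; do !case: ifP.
(* The outer states are constant, so conservation of paths leaves one crossing on each side. *)
rewrite (bigD1 (false, false)) //= [RHS](bigD1 (right, right)) //=.
rewrite !update2_const !ffunE !big1; first by case: right; rewrite !addr0.
  by move=> -[[] []]; case: right; rewrite /= ?mulr0.
by move=> -[[] []]; rewrite /= ?mul0r.
Qed.

End RowExchange.

(** * Reduction of configuration sums to finitely many columns *)

Section Extension.
Variables (T : Type) (n : nat).

Definition extend (f : {ffun 'I_n -> T}) (d : T) (i : nat) : T :=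
  if insub i is Some i' then f i' else d.

Lemma extend_ord f d (i : 'I_n) : extend f d i = f i.
Proof. by rewrite /extend valK. Qed.

Lemma extend_out f d i : (n <= i)%N -> extend f d i = d.
Proof. by move=> le_n_i; rewrite /extend insubF // ltnNge le_n_i. Qed.

Lemma extend_restrict (g : nat -> T) d i :
  ((n <= i)%N -> g i = d) -> extend [ffun i' : 'I_n => g i'] d i = g i.
Proof.
case: (ltnP i n) => [lt_i_n _|le_n_i gi]; last by rewrite extend_out ?gi.
by rewrite (extend_ord _ _ (Ordinal lt_i_n)) ffunE.
Qed.

End Extension.

(** The sum is 0 or [k], an extreme value, which only a constant function attains. *)
Lemma sum_bool_const k (f : 'I_k -> bool) (b : bool) :
  (\sum_j (f j : nat) = \sum_(j < k) (b : nat))%N -> forall j, f j = b.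
Proof.
case: b => [sum1 j|]; last first.
  rewrite [RHS]big1 // => /eqP; rewrite sum_nat_eq0 => /forallP f0 j.
  by apply/negbTE; rewrite -eqb0 -(eqP (f0 j)).
have /leqif_sum[_] : forall j : 'I_k, true -> (f j <= true ?= iff f j)%N.
  by move=> i _; case: (f i); split.
by rewrite sum1 eqxx => /esym/forallP/(_ j).
Qed.

(** There are [N.+1] families of horizontal edges because both outer sides of the [N] columns are
    included. *)
Definition truncated k N : Type :=
  ({ffun 'I_N.+1 -> {ffun 'I_k -> bool}} *
   {ffun 'I_N -> {ffun 'I_k.+1 -> bool}})%type.

Definition extend_config k N right (d : truncated k N) : config k :=
  (fun i => extend d.2 [ffun=> false] i : 'I_k.+1 -> bool,
   fun i => extend d.1 [ffun=> right] i : 'I_k -> bool).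

Definition valid k N (bot top : seq nat) right (d : truncated k N) : bool :=
  [&& d.1 ord0 == [ffun=> false], d.1 ord_max == [ffun=> right] &
    [forall i : 'I_N, (d.2 i ord0 == (i.+1 \in bot)) &&
                      (d.2 i ord_max == (i.+1 \in top))]].

Section ConfigSum.
Variables (K : fieldType) (k : nat).
Variables (w : bool -> bool -> bool -> bool -> K -> K -> K -> K -> K).
Variables (x : 'I_k -> K) (y : nat -> K) (r : 'I_k -> K) (s : nat -> K).
Variables (bot top : seq nat) (right : bool) (N : nat).

Definition local_weight i j a b c d := w a b c d (x j) (y i) (r j) (s i).

Hypothesis w_conserve : forall a b c d x y r s,
  w a b c d x y r s != 0 -> (a + b = c + d)%N.
Hypothesis w_empty : forall i j, local_weight i j false right false right = 1.
Hypothesis N_bot : forall i, (N <= i)%N -> (i.+1 \in bot) = false.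
Hypothesis N_top : forall i, (N <= i)%N -> (i.+1 \in top) = false.

Definition truncated_weight (d : truncated k N) : K :=
  \prod_(i < N) \prod_j local_weight i j
    (d.2 i (widen_ord (leqnSn k) j)) (d.1 (widen_ord (leqnSn N) i) j)
    (d.2 i (lift ord0 j)) (d.1 (lift ord0 i) j).

(** Distributing the product over columns over their sums gives one term for each choice of all
    edges. *)
Lemma partition_function_truncated :
  partition_function N local_weight bot top right =
  \sum_(d | valid bot top right d) truncated_weight d.
Proof.
rewrite /partition_function {1}/path_sum.
under eq_bigr do rewrite bigA_distr_big_dep.
rewrite pair_big_dep /=; apply: eq_bigl => -[h v]; rewrite /valid /= -andbA.
do 2!congr (_ && _); apply/familyP/forallP => vP i; have := vP i; rewrite inE.
Qed.

Section Extended.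
Variable d : truncated k N.
Hypothesis d_valid : valid bot top right d.

Lemma vertex_weight_in (i : 'I_N) j :
  vertex_weight w x y r s (extend_config right d) (val i, j) = local_weight i j
    (d.2 i (widen_ord (leqnSn k) j)) (d.1 (widen_ord (leqnSn N) i) j)
    (d.2 i (lift ord0 j)) (d.1 (lift ord0 i) j).
Proof.
rewrite /= !extend_ord (extend_ord _ _ (widen_ord (leqnSn N) i)).
by rewrite (extend_ord _ _ (lift ord0 i)).
Qed.

Lemma extend_right i : (N <= i)%N -> extend d.1 [ffun=> right] i = [ffun=> right].
Proof.
(* Index [N] is still stored in [d.1], where validity gives its value; the default starts at
   [N.+1]. *)
rewrite leq_eqVlt => /predU1P[<-|]; last exact: extend_out.
by rewrite (extend_ord _ _ ord_max); case/and3P: d_valid => _ /eqP.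
Qed.

Lemma vertex_weight_out i j : (N <= i)%N ->
  vertex_weight w x y r s (extend_config right d) (i, j) = 1.
Proof.
move=> le_N_i; rewrite /= extend_out // !extend_right ?(leqW le_N_i) // !ffunE.
exact: w_empty.
Qed.

Lemma config_weight_extend :
  config_weight w x y r s (extend_config right d) = truncated_weight d.
Proof.
(* Factors beyond the truncation are 1, so a zero factor lies inside and makes the finite product
   vanish too. *)
rewrite /config_weight; case: asboolP => [[[i j] wij0]|_].
  have lt_i_N : (i < N)%N.
    case: ltnP => // /(vertex_weight_out j); rewrite wij0 => /esym/eqP.
    by rewrite oner_eq0.
  rewrite (vertex_weight_in (Ordinal lt_i_N)) in wij0.
  apply/esym/eqP; rewrite prodf_seq_eq0; apply/hasP.
  exists (Ordinal lt_i_N); rewrite ?mem_index_enum //=.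
  by rewrite prodf_seq_eq0; apply/hasP; exists j; rewrite ?mem_index_enum ?wij0 /=.
pose inside (p : 'I_N * 'I_k) : nat * 'I_k := (val p.1, p.2).
rewrite -(fsbig_widen (inside @` [set` predT])) //; last first.
  move=> -[i j] [_ /= not_in]; apply: vertex_weight_out; rewrite leqNgt.
  by apply/negP => lt_i_N; apply: not_in; exists (Ordinal lt_i_N, j).
rewrite fsbig_image; last by move=> -[i j] [i' j'] _ _ [/val_inj-> ->].
rewrite -(@bigfs _ _ _ _ (index_enum _)) ?index_enum_uniq //; last first.
  by move=> p _; rewrite mem_index_enum.
rewrite /truncated_weight pair_bigA /=.
by apply: eq_bigr => -[i j] _; exact: vertex_weight_in.
Qed.

Lemma extend_config_configs : configs bot top right (extend_config right d).
Proof.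
case/and3P: d_valid => /eqP h0 /eqP hN /forallP vP; split=> /= [i|i|j|].
- have [lt_i_N|le_N_i] := ltnP i N; last by rewrite extend_out // ffunE N_bot.
  rewrite (extend_ord _ _ (Ordinal lt_i_N)).
  by have /andP[/eqP] := vP (Ordinal lt_i_N).
- have [lt_i_N|le_N_i] := ltnP i N; last by rewrite extend_out // ffunE N_top.
  rewrite (extend_ord _ _ (Ordinal lt_i_N)).
  by have /andP[_ /eqP] := vP (Ordinal lt_i_N).
- by rewrite (extend_ord _ _ ord0) h0 ffunE.
- by exists N => i j /extend_right->; rewrite ffunE.
Qed.

End Extended.

Lemma extend_config_inj : injective (@extend_config k N right).
Proof.
move=> [h v] [h' v'] [] eq_v eq_h; congr pair; apply/ffunP => i; apply/ffunP => j.
  by have := congr1 (fun f => f (val i) j) eq_h; rewrite !extend_ord.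
by have := congr1 (fun f => f (val i) j) eq_v; rewrite !extend_ord.
Qed.

(* Beyond column N no path enters or leaves vertically, so by conservation the
   number of horizontal edges is constant there, hence equal to its value at
   infinity. *)
Lemma nonzero_config_extend c :
  configs bot top right c -> config_weight w x y r s c != 0 ->
  exists2 d : truncated k N, valid bot top right d & c = extend_config right d.
Proof.
case: c => v h [/= v_bot v_top h0 [M hM]].
rewrite /config_weight; case: asboolP => [_|nz _]; first by rewrite eqxx.
have conserve i j : (v i (widen_ord (leqnSn k) j) + h i j =
                     v i (lift ord0 j) + h i.+1 j)%N.
  apply: (@w_conserve _ _ _ _ (x j) (y i) (r j) (s i)); apply/eqP => w0.
  by apply: nz; exists (i, j).
have row_const i : (N <= i)%N -> (\sum_j h i j = \sum_j h i.+1 j)%N.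
  move=> le_N_i; have : (\sum_(l < k.+1) v i l = \sum_(l < k.+1) v i l)%N by [].
  rewrite {1}big_ord_recr big_ord_recl /= v_bot v_top N_bot ?N_top //.
  rewrite addn0 add0n => eq_v; apply/eqP.
  rewrite -(eqn_add2l (\sum_j v i (lift ord0 j))) -{1}eq_v -!big_split /=.
  by apply/eqP/eq_bigr => j _.
have h_right i j : (N <= i)%N -> h i j = right.
  move=> le_N_i; apply: sum_bool_const j.
  have -> : (\sum_j h i j = \sum_j h (M + i)%N j)%N.
    by elim: M {hM} => [|m ->] //; rewrite row_const // (leq_trans le_N_i) ?leq_addl.
  by apply: eq_bigr => j _; rewrite hM ?leq_addr.
(* Here each vertex has equal horizontal edges on its two sides, so by conservation the empty bottom
   edge propagates upwards. *)
have v_out i l : (N <= i)%N -> v i l = false.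
  move=> le_N_i; case: l => l; elim: l => [|l IHl] lt_l.
    by rewrite -(N_bot le_N_i) -v_bot; congr (v i _); apply: val_inj.
  have /eqP := conserve i (Ordinal (lt_l : l < k)%N).
  rewrite !h_right ?(leqW le_N_i) // eqn_add2r.
  rewrite (_ : widen_ord _ _ = Ordinal (ltnW lt_l)); last exact: val_inj.
  rewrite (_ : lift _ _ = Ordinal lt_l); last exact: val_inj.
  by rewrite IHl; case: (v i _).
exists ([ffun i : 'I_N.+1 => [ffun j => h i j]],
        [ffun i : 'I_N => [ffun l => v i l]]).
  apply/and3P; split=> /=.
  - by apply/eqP/ffunP => j; rewrite !ffunE h0.
  - by apply/eqP/ffunP => j; rewrite !ffunE h_right.
  - by apply/forallP => i; rewrite !ffunE v_bot v_top !eqxx.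
congr pair; apply/funext => i; apply/funext => j /=.
  rewrite (extend_restrict (g := fun i => [ffun l => v i l])) ?ffunE //.
  by move=> le_N_i; apply/ffunP => l; rewrite !ffunE v_out.
rewrite (extend_restrict (g := fun i => [ffun l => h i l])) ?ffunE //.
by move=> /ltnW le_N_i; apply/ffunP => l; rewrite !ffunE h_right.
Qed.

(** Extension is injective on truncated data, and by [nonzero_config_extend] no other configuration
    contributes. *)
Lemma sum_configs :
  \sum_(c \in configs bot top right) config_weight w x y r s c =
  partition_function N local_weight bot top right.
Proof.
rewrite partition_function_truncated.
rewrite -(fsbig_widen (@extend_config k N right @` [set` valid bot top right])).
- rewrite fsbig_image; last by move=> d d' _ _; exact: extend_config_inj.
  rewrite -(@bigfs _ _ _ _ (index_enum _)) ?index_enum_uniq //; last first.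
    by move=> d _; rewrite mem_index_enum.
  by apply: eq_bigr => d /config_weight_extend.
- by move=> _ [d d_valid <-]; exact: extend_config_configs.
move=> c [c_conf /= not_im]; apply/eqP; apply: contrapT => /negP w_neq0.
by apply: not_im; have [d ? ->] := nonzero_config_extend c_conf w_neq0; exists d.
Qed.

End ConfigSum.

(** * Symmetry even where the crossing weight vanishes *)

Lemma partition_function_sym (K : fieldType) k N (i i' : 'I_k)
    (i'E : i' = i.+1 :> nat) (x q : 'I_k -> K) (y t : nat -> K) bot top :
  partition_function N
    (row_weight y t (x \o tperm i i') (q \o tperm i i')) bot top false =
  partition_function N (row_weight y t x q) bot top false.
Proof.
(* The factor [x i - x i' * q i'] of the exchange relation may vanish, hence the
   detour through K[X]: perturb [x i] to [x i + 'X], cancel, and let 'X be 0. *)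
pose xX j : {poly K} := (x j)%:P + (if j == i then 'X else 0).
pose qX j : {poly K} := (q j)%:P.
pose yX n : {poly K} := (y n)%:P.
pose tX n : {poly K} := (t n)%:P.
have i'i : (i' == i) = false by rewrite -val_eqE /= i'E gtn_eqF.
(* Only [xX i] involves ['X], so the coefficient of ['X] in this factor is 1. *)
have factor_neq0 : xX i - xX i' * qX i' != 0.
  apply/eqP => /(congr1 (fun p : {poly K} => p`_1)).
  rewrite /xX /qX eqxx i'i addr0 -polyCM coefB coefD !coefC coefX /=.
  by rewrite add0r subr0 => /eqP; rewrite oner_eq0.
have specialize (x' q' : 'I_k -> {poly K}) u v : (forall j, (x' j).[0] = u j) ->
    (forall j, (q' j).[0] = v j) ->
    (partition_function N (row_weight yX tX x' q') bot top false).[0] =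
    partition_function N (row_weight y t u v) bot top false.
  move=> x'E q'E; rewrite -[LHS]/(horner_eval 0 _) rmorph_partition_function.
  apply: eq_partition_function => n j a b c d.
  by rewrite /row_weight rmorph_vertex /= /horner_eval x'E q'E !hornerC.
have xX0 j : (xX j).[0] = x j.
  by rewrite /xX; case: ifP => _; rewrite !hornerE.
have qX0 j : (qX j).[0] = q j by rewrite hornerC.
rewrite -(specialize (xX \o tperm i i') (qX \o tperm i i')) //; last 2 first.
- by move=> j; exact: xX0.
- by move=> j; exact: qX0.
rewrite -(specialize xX qX) //; congr horner.
apply: (mulIf factor_neq0); rewrite [RHS]mulrC.
by rewrite (partition_function_exchange i'E).
Qed.

(** * Clearing denominators in [W] and [What] *)

Section Weights.
Variable K : fieldType.
Implicit Types x y r s : K.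

Lemma W_conserve a b c d x y r s :
  W a b c d x y r s != 0 -> (a + b = c + d)%N.
Proof. by case: a b c d => [] [] [] []; rewrite /= ?eqxx. Qed.

Lemma What_conserve a b c d x y r s :
  What a b c d x y r s != 0 -> (a + b = c + d)%N.
Proof. by rewrite mulf_eq0 negb_or => /andP[/W_conserve]. Qed.

Lemma W_vertex a b c d x y r s : s ^- 2 * y - x != 0 ->
  W a b c d x y r s = (s ^- 2 * y - x)^-1 * vertex a b c d x y (r ^- 2) (s ^- 2).
Proof.
by move=> nz; case: a b c d => [] [] [] []; rewrite /= ?mulr0 ?mulVf // mulrC.
Qed.

(** Dividing by the weight [(y - x) / (s ^- 2 * y - x)] trades one common denominator for
    another. *)
Lemma What_vertex a b c d x y r s : s ^- 2 * y - x != 0 -> y - x != 0 ->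
  What a b c d x y r s = (y - x)^-1 * vertex a b c d x y (r ^- 2) (s ^- 2).
Proof.
move=> nz nz'; rewrite /What W_vertex // W_vertex //= invfM invrK.
by rewrite mulrACA mulVf // mul1r mulrC.
Qed.

End Weights.

(** * The symmetrizing product for [F] *)

Section CrossProduct.
Variables (K : fieldType) (k : nat) (i i' : 'I_k).
Hypothesis i'E : i' = i.+1 :> nat.
Notation tau := (tperm i i').

Definition cross_product (x r : 'I_k -> K) :=
  \prod_(i < k) \prod_(j < k | (i < j)%N) (x i - x j * r j ^- 2).

(** An adjacent transposition reverses the order of no pair except [(i, i')]. It therefore only
    permutes the other factors, whose product is [c]. *)
Lemma cross_product_tperm (x r : 'I_k -> K) : exists2 c,
  cross_product x r = (x i - x i' * r i' ^- 2) * c &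
  cross_product (x \o tau) (r \o tau) = (x i' - x i * r i ^- 2) * c.
Proof.
have lt_ii' : (i < i')%N by rewrite i'E.
rewrite /cross_product !pair_big_dep /= (bigD1 (i, i')) //=.
eexists; first by [].
rewrite (bigD1 (i, i')) //= tpermL tpermR; congr (_ * _).
pose tau2 (p : 'I_k * 'I_k) := (tau p.1, tau p.2).
rewrite [RHS](reindex_inj (h := tau2)) /=; last first.
  by move=> [a b] [a' b'] [/perm_inj-> /perm_inj->].
apply: eq_bigl => -[a b]; rewrite !xpair_eqE /=.
have tau_lt (c d : 'I_k) : (c < d)%N -> (c, d) != (i, i') ->
    (tau c < tau d)%N && ((tau c, tau d) != (i, i')).
  rewrite !xpair_eqE; case: tpermP => [->|->|]; case: tpermP => [->|->|];
    rewrite -?val_eqE /=; lia.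
apply/andP/andP => [[lt_ab ne_ab]|[]].
  by apply/andP/tau_lt.
move=> lt_ab ne_ab; have /andP[] := tau_lt _ _ lt_ab ne_ab.
by rewrite !tpermK.
Qed.

End CrossProduct.

(** * Exchange relations for [G] and [F] *)

Section BranchingFunctions.
Variables (K : fieldType) (k : nat) (y s : nat -> K) (lam mu : seq nat).
Implicit Types x r : 'I_k -> K.

Local Notation t := (fun n => s n ^- 2).
Local Notation sq r := (fun j => r j ^- 2).

(** Column index [i] stands for the site [i.+1], so all indices from [N] on are unoccupied. *)
Let N := (\max_(i <- occupied lam ++ occupied mu) i)%N.

Lemma occupied_lam_le i : (N <= i)%N -> (i.+1 \in occupied lam) = false.
Proof.
apply: contraTF => i_in; rewrite -ltnNge.
by apply: (@leq_bigmax_seq _ _ predT id); rewrite // mem_cat i_in.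
Qed.

Lemma occupied_mu_le i : (N <= i)%N -> (i.+1 \in occupied mu) = false.
Proof.
apply: contraTF => i_in; rewrite -ltnNge.
by apply: (@leq_bigmax_seq _ _ predT id); rewrite // mem_cat i_in orbT.
Qed.

(** The prefactor is symmetric in the [x j], so only the polynomial partition function matters for
    the exchange. *)
Lemma G_partition_function x r : (forall i j, s i ^- 2 * y i - x j != 0) ->
  size lam = size mu ->
  G lam mu x y r s =
    (\prod_(i < N) \prod_j (s i ^- 2 * y i - x j)^-1) *
    partition_function N (row_weight y t x (sq r))
      (occupied mu) (occupied lam) false.
Proof.
move=> nz eq_size; rewrite /G eq_size eqxx.
rewrite (sum_configs (N := N)) //.
- rewrite -(partition_functionZ N (fun i j => (s i ^- 2 * y i - x j)^-1)).
  apply: eq_partition_function => i j a b c d.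
  exact: W_vertex.
- exact: W_conserve.
- exact: occupied_mu_le.
- exact: occupied_lam_le.
Qed.

Lemma F_partition_function x r : (forall i j, s i ^- 2 * y i - x j != 0) ->
  (forall i j, y i - x j != 0) -> size lam = (size mu + k)%N ->
  F lam mu x y r s =
    (\prod_(i < N) \prod_j (y i - x j)^-1) *
    partition_function N (row_weight y t x (sq r))
      (occupied lam) (occupied mu) true.
Proof.
move=> nz nz' eq_size; rewrite /F eq_size eqxx.
rewrite (sum_configs (N := N)) //.
- rewrite -(partition_functionZ N (fun i j => (y i - x j)^-1)).
  apply: eq_partition_function => i j a b c d.
  exact: What_vertex.
- exact: What_conserve.
(* Far to the right every vertex has only its horizontal edges occupied, the state that [What]
   normalizes to 1. *)
- by move=> i j; rewrite /local_weight /What divff // /W mulf_neq0 ?invr_neq0.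
- exact: occupied_lam_le.
- exact: occupied_mu_le.
Qed.

Lemma prod_perm (f : nat -> K -> K) x (p : {perm 'I_k}) :
  \prod_(i < N) \prod_j f i ((x \o p) j) = \prod_(i < N) \prod_j f i (x j).
Proof.
by apply: eq_bigr => i _; rewrite [RHS](reindex_inj (@perm_inj _ p)).
Qed.

Variables (i i' : 'I_k).
Hypothesis i'E : i' = i.+1 :> nat.
Notation tau := (tperm i i').

Lemma G_tperm x r : (forall i j, s i ^- 2 * y i - x j != 0) ->
  G lam mu (x \o tau) y (r \o tau) s = G lam mu x y r s.
Proof.
move=> nz; have [eq_size|ne_size] := eqVneq (size lam) (size mu); last first.
  by rewrite /G (negPf ne_size).
rewrite !G_partition_function //; last by move=> n j; exact: nz.
rewrite (prod_perm (fun n c => (s n ^- 2 * y n - c)^-1)); congr (_ * _).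
exact: (partition_function_sym _ i'E x (sq r)).
Qed.

(** Stated without division, so that it applies to arbitrary permutations even when a crossing
    factor vanishes. *)
Lemma F_tperm x r : (forall i j, s i ^- 2 * y i - x j != 0) ->
  (forall i j, y i - x j != 0) ->
  F lam mu (x \o tau) y (r \o tau) s * (x i' - x i * r i ^- 2) =
  (x i - x i' * r i' ^- 2) * F lam mu x y r s.
Proof.
move=> nz nz'.
have [eq_size|ne_size] := eqVneq (size lam) (size mu + k)%N; last first.
  by rewrite /F (negPf ne_size) mul0r mulr0.
rewrite !F_partition_function //; last 2 first.
- by move=> n j; exact: nz.
- by move=> n j; exact: nz'.
rewrite (prod_perm (fun n c => (y n - c)^-1)) mulrCA -mulrA; congr (_ * _).
by rewrite (partition_function_exchange i'E x (sq r)).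
Qed.

End BranchingFunctions.

(** * From adjacent transpositions to all permutations *)

(** A transposition of distant indices is obtained by induction on their distance: conjugating
    [tperm i j1], with [j1] just before [j], by [tperm j1 j] gives [tperm i j]. *)
Lemma perm_adjacent_ind k (P : {perm 'I_k} -> Prop) :
  P 1%g -> (forall p p', P p -> P p' -> P (p * p')%g) ->
  (forall i i' : 'I_k, i' = i.+1 :> nat -> P (tperm i i')) ->
  forall p, P p.
Proof.
move=> P1 PM Padj.
have P_lt n : forall i j : 'I_k, j = (i + n.+1)%N :> nat -> P (tperm i j).
  elim: n => [|n IHn] i j jE; first by apply: Padj; rewrite jE addn1.
  have lt_j1 : (i + n.+1 < k)%N by have := ltn_ord j; lia.
  pose j1 := Ordinal lt_j1.
  have j1j : P (tperm j1 j) by apply: Padj; rewrite jE addnS.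
  have <- : (tperm i j1 ^ tperm j1 j)%g = tperm i j.
    rewrite tpermJ tpermL tpermD // -val_eqE /= ?jE.
      by rewrite gtn_eqF // addnS ltnS leq_addr.
    by rewrite gtn_eqF // addnS ltnS leq_addr.
  by rewrite /conjg tpermV; apply: (PM); [|apply: PM; first exact: IHn].
have P_tperm i j : P (tperm i j).
  have [lt_ij|lt_ji|/val_inj->] := ltngtP i j; last by rewrite tperm1.
    by apply: (P_lt (j - i.+1)%N); rewrite addnS -addSn subnKC.
  by rewrite tpermC; apply: (P_lt (i - j.+1)%N); rewrite addnS -addSn subnKC.
move=> p; have [ts -> _] := prod_tpermP p.
by elim: ts => [|[i j] ts IHts]; rewrite ?big_nil // big_cons; apply: PM.
Qed.

Theorem proposition3p5 (K : fieldType) (k : nat) (k_ge1 : (1 <= k)%N)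
    (x r : 'I_k -> K) (y s : nat -> K) (lam mu : seq nat)
    (lam_sig : is_signature lam) (mu_sig : is_signature mu)
    (r_neq0 : forall j, r j != 0) (s_neq0 : forall i, s i != 0)
    (W_def : forall i j, s i ^- 2 * y i - x j != 0) :
  [/\ forall i i' : 'I_k, i' = i.+1 :> nat ->
        G lam mu (x \o tperm i i') y (r \o tperm i i') s = G lam mu x y r s,
      (forall i j, y i - x j != 0) ->
      forall i i' : 'I_k, i' = i.+1 :> nat ->
        x i' - x i * r i ^- 2 != 0 ->
        F lam mu (x \o tperm i i') y (r \o tperm i i') s =
          (x i - x i' * r i' ^- 2) / (x i' - x i * r i ^- 2)
            * F lam mu x y r s,
      forall sigma : {perm 'I_k},
        G lam mu (x \o sigma) y (r \o sigma) s = G lam mu x y r s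
    & (forall i j, y i - x j != 0) ->
      forall sigma : {perm 'I_k},
        F lam mu (x \o sigma) y (r \o sigma) s
            * \prod_(i < k) \prod_(j < k | (i < j)%N)
                ((x \o sigma) i - (x \o sigma) j * (r \o sigma) j ^- 2) =
          F lam mu x y r s
            * \prod_(i < k) \prod_(j < k | (i < j)%N)
                (x i - x j * r j ^- 2)].
Proof.
(* The product of permutations applies its left factor first, hence the reversed order. *)
have compM (u : 'I_k -> K) (p p' : {perm 'I_k}) : u \o (p * p')%g = (u \o p') \o p.
  by apply/funext => j; rewrite /= permM.
have comp1 (u : 'I_k -> K) : u \o (1 : {perm 'I_k})%g = u.
  by apply/funext => j; rewrite /= perm1.
split.
- by move=> i i' i'E; exact: G_tperm.
- move=> nz' i i' i'E nz; apply: (mulIf nz); rewrite F_tperm //.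
  by rewrite mulrAC divfK.
(* The parameters are generalized because the product case applies one hypothesis to already
   permuted [x] and [r]. *)
- move=> sigma; elim/perm_adjacent_ind: sigma x r {r_neq0} W_def
    => [|p p' IHp IHp'|i i' i'E] x r W_def.
  + by rewrite !comp1.
  + by rewrite !compM IHp ?IHp' // => i j; exact: W_def.
  + exact: G_tperm.
- move=> nz' sigma; rewrite -!/(cross_product _ _).
  elim/perm_adjacent_ind: sigma x r {r_neq0} W_def nz'
    => [|p p' IHp IHp'|i i' i'E] x r W_def nz'.
  + by rewrite !comp1.
  + rewrite !compM IHp ?IHp' // => i j; [exact: W_def|exact: nz'].
  (* The factor [x i' - x i * r i ^- 2] of the permuted product is the one that [F_tperm]
     absorbs. *)
  + have [c -> ->] := cross_product_tperm i'E x r.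
    by rewrite mulrA F_tperm // -mulrA mulrCA.
Qed.
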